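(* Let $W\in\mathbb{R}^{m\times n}$ have full row rank and let $\mathbf{u}^k,\mathbf{y}^k$ (with $\mathbf{z}^k=\mathbf{z}(\mathbf{u}^k)$) be the current iterate generated by Algorithm A (described in the context). Then the global optimal solution $\mathbf{u}^{k+1}$ of the $\mathbf{u}$-subproblem $$\min_{\mathbf{u}\in\mathbb{R}^n}\Big\{f(\mathbf{u})+\langle W\mathbf{u}-\mathbf{y}^k,\mathbf{z}^k\rangle+\tfrac{\beta}{2}\|W\mathbf{u}\|^2+\tfrac{t_k}{2}\|\mathbf{u}-\mathbf{u}^k\|^2+\tfrac{\rho}{2}\|W\mathbf{u}-\mathbf{y}^k\|^2\Big\}$$ is $$\mathbf{u}^{k+1}=\big(A^{\top}A+(\beta+\rho)W^{\top}W+t_kI\big)^{-1}\big(A^{\top}\mathbf{u}_0-W^{\top}\mathbf{z}^k+\rho W^{\top}\mathbf{y}^k+t_k\mathbf{u}^k\big),$$ and a global optimal solution of the $\mathbf{y}$-subproblem $$\min_{\mathbf{y}\in\mathbb{R}^m}\Big\{\lambda\|\mathbf{y}\|_0+\langle W\mathbf{u}^{k+1}-\mathbf{y},\mathbf{z}^{k+1}\rangle+\tfrac{t_k}{2}\|\mathbf{y}-\mathbf{y}^k\|^2+\tfrac{\rho}{2}\|W\mathbf{u}^{k+1}-\mathbf{y}\|^2\Big\}$$ is $$\mathbf{y}^{k+1}=\mathcal{H}_{\sqrt{2\lambda/(\rho+t_k)}}\Big(\tfrac{\rho}{\rho+t_k}W\mathbf{u}^{k+1}+\tfrac{t_k}{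\rho+t_k}\mathbf{y}^k+\tfrac{1}{\rho+t_k}\mathbf{z}^{k+1}\Big).$$
   Context: Data: $A\in\mathbb{R}^{p\times n}$, $\mathbf{u}_0\in\mathbb{R}^p$, $f(\mathbf{u})=\frac12\|A\mathbf{u}-\mathbf{u}_0\|^2$, constants $\lambda,\beta,\rho>0$ and $t_k>0$. $\|\cdot\|$ is the Euclidean norm, $\|\mathbf{y}\|_0$ is the number of nonzero entries of $\mathbf{y}$, and $\dagger$ denotes the Moore–Penrose pseudoinverse. $\mathbf{z}(\mathbf{u})=(W^{\top})^{\dagger}(-\nabla f(\mathbf{u})-\beta W^{\top}W\mathbf{u})$. The hard thresholding operator $\mathcal{H}_\mu$ ($\mu>0$) acts componentwise: $\mathcal{H}_\mu(s)=s$ if $|s|>\mu$ and $\mathcal{H}_\mu(s)=0$ if $|s|\le\mu$. Algorithm A: choose $\mathbf{u}^0\in\mathbb{R}^n$, set $\mathbf{y}^0=W\mathbf{u}^0$, $\mathbf{z}^0=\mathbf{z}(\mathbf{u}^0)$. For $k=0,1,2,\dots$: let $\mathbf{u}^{k+1}$ be the minimizer of the $\mathbf{u}$-subproblem displayed in the claim; set $\mathbf{z}^{k+1}=\mathbf{z}(\mathbf{u}^{k+1})$; let $\mathbf{y}^{k+1}$ be a minimizer of the $\mathbf{y}$-subproblem displayed in the claim. *)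

(* Defs.v *)
From HB Require Import structures.
From mathcomp Require Import all_boot all_order all_algebra.
From mathcomp Require Import boolp classical_sets reals topology normedtype derive.
Set Implicit Arguments.
Unset Strict Implicit.
Unset Printing Implicit Defensive.
Import Order.TTheory GRing.Theory Num.Theory.
Import numFieldNormedType.Exports.
Local Open Scope ring_scope.

Definition inner (R : realType) (n : nat) (x y : 'cV[R]_n) : R :=
  \sum_(i < n) x i 0 * y i 0.

(* The library norm on matrices is the sup norm, hence a separate Euclidean
   norm. *)
Definition enorm (R : realType) (n : nat) (x : 'cV[R]_n) : R :=
  Num.sqrt (\sum_(i < n) x i 0 ^+ 2).

Definition norm0 (R : realType) (n : nat) (x : 'cV[R]_n) : nat :=
  #|[set i : 'I_n | x i 0 != 0]|.

Definition hard_threshold (R : realType) (mu : R) (n : nat) (x : 'cV[R]_n) :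
    'cV[R]_n :=
  map_mx (fun s => if mu < `|s| then s else 0) x.

Definition gradient (R : realType) (n : nat) (f : 'cV[R]_n -> R)
    (u : 'cV[R]_n) : 'cV[R]_n :=
  \col_(i < n) derive f u (delta_mx i 0 : 'cV[R]_n).

Definition global_minimizer (R : realType) (T : Type) (F : T -> R) (x : T) :
    Prop :=
  forall y : T, F x <= F y.

Definition penrose (R : realType) (m n : nat) (A : 'M[R]_(m, n))
    (X : 'M[R]_(n, m)) : Prop :=
  [/\ A *m X *m A = A, X *m A *m X = X,
      (A *m X)^T = A *m X & (X *m A)^T = X *m A].

(* Well defined by [penrose_unique] and [mpinvP] below. The library's [pinvmx]
   is only a one-sided inverse on the row space. *)
Definition mpinv (R : realType) (m n : nat) (A : 'M[R]_(m, n)) :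
    'M[R]_(n, m) :=
  xget 0 [set X | penrose A X]%classic.

Lemma penrose_unique (R : realType) (m n : nat) (A : 'M[R]_(m, n))
    (X Y : 'M[R]_(n, m)) :
  penrose A X -> penrose A Y -> X = Y.
Proof.
move=> [AXA XAX sAX sXA] [AYA YAY sAY sYA].
have eAX : A *m X = A *m Y.
  by rewrite -[LHS]sAX -{1}AYA -mulmxA trmx_mul sAX sAY !mulmxA AXA.
have eXA : X *m A = Y *m A.
  by rewrite -[LHS]sXA -{1}AYA !mulmxA -(mulmxA (X *m A)) trmx_mul sXA sYA
             -mulmxA (mulmxA A) AXA.
by rewrite -XAX -mulmxA eAX mulmxA eXA YAY.
Qed.

Lemma gram_unit (R : realType) (r n : nat) (B : 'M[R]_(r, n)) :
  row_free B -> B *m B^T \in unitmx.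
Proof.
move=> fB; rewrite -row_free_unit -kermx_eq0; apply/rowV0P => v /sub_kermxP.
rewrite mulmxA => vBB; suff vB : v *m B = 0.
  by apply/(row_free_inj fB); rewrite mul0mx.
have : ((v *m B) *m (v *m B)^T) 0 0 = 0.
  by rewrite trmx_mul mulmxA vBB mul0mx mxE.
rewrite mxE => /psumr_eq0P H; apply/rowP => j; rewrite [RHS]mxE.
apply/eqP; rewrite -[_ == 0]sqrf_eq0 expr2; apply/eqP.
have := H _ j isT; rewrite [X in _ * X]mxE; apply=> i _.
by rewrite [X in _ * X]mxE -expr2 sqr_ge0.
Qed.

Lemma penrose_full_rank (R : realType) (m r n : nat) (C : 'M[R]_(m, r))
    (B : 'M[R]_(r, n)) :
  B *m B^T \in unitmx -> C^T *m C \in unitmx ->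
  exists X, penrose (C *m B) X.
Proof.
move=> uB uC; pose G := invmx (B *m B^T); pose H := invmx (C^T *m C).
have sG : G^T = G by rewrite /G trmx_inv trmx_mul trmxK.
have sH : H^T = H by rewrite /H trmx_inv trmx_mul trmxK.
pose X := B^T *m G *m (H *m C^T).
have AX : C *m B *m X = C *m H *m C^T.
  by rewrite /X !mulmxA -(mulmxA C B) -(mulmxA C _ G) mulmxV // mulmx1.
have XA : X *m (C *m B) = B^T *m G *m B.
  rewrite /X -!mulmxA (mulmxA C^T) (mulmxA H) mulVmx // mul1mx.
  by rewrite !mulmxA.
exists X; split.
- by rewrite AX !mulmxA -(mulmxA _ C^T) -(mulmxA C) mulVmx // mulmx1.
- rewrite XA /X !mulmxA -(mulmxA _ B) -(mulmxA (B^T *m G)) mulmxV //.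
  by rewrite mulmx1.
- by rewrite AX !trmx_mul trmxK sH mulmxA.
- by rewrite XA !trmx_mul trmxK sG mulmxA.
Qed.

Lemma penrose_exists (R : realType) (m n : nat) (A : 'M[R]_(m, n)) :
  exists X, penrose A X.
Proof.
have := @penrose_full_rank R m _ n (col_base A) (row_base A).
rewrite mulmx_base; apply; first exact/gram_unit/row_base_free.
rewrite -{2}[col_base A]trmxK; apply: gram_unit.
by rewrite /row_free mxrank_tr; have := col_base_full A; rewrite /row_full.
Qed.

Lemma mpinvP (R : realType) (m n : nat) (A : 'M[R]_(m, n)) :
  penrose A (mpinv A).
Proof.
have [X PX] := penrose_exists A.
exact: (@xgetPex _ _ [set X | penrose A X]%classic (ex_intro _ X PX)).
Qed.

Definition fid (R : realType) (p n : nat) (A : 'M[R]_(p, n)) (b : 'cV[R]_p)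
    (u : 'cV[R]_n) : R :=
  2^-1 * enorm (A *m u - b) ^+ 2.

Definition zmap (R : realType) (p n m : nat) (A : 'M[R]_(p, n))
    (b : 'cV[R]_p) (W : 'M[R]_(m, n)) (beta : R) (u : 'cV[R]_n) : 'cV[R]_m :=
  mpinv W^T *m (- gradient (fid A b) u - beta *: (W^T *m W *m u)).

Definition uobj (R : realType) (p n m : nat) (A : 'M[R]_(p, n))
    (b : 'cV[R]_p) (W : 'M[R]_(m, n)) (beta rho tk : R)
    (uk : 'cV[R]_n) (yk zk : 'cV[R]_m) (u : 'cV[R]_n) : R :=
  fid A b u + inner (W *m u - yk) zk + beta / 2 * enorm (W *m u) ^+ 2
  + tk / 2 * enorm (u - uk) ^+ 2 + rho / 2 * enorm (W *m u - yk) ^+ 2.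

(* [u1] and [z1] are the new values, [yk] the old one. *)
Definition yobj (R : realType) (n m : nat) (W : 'M[R]_(m, n))
    (lambda rho tk : R) (u1 : 'cV[R]_n) (yk z1 : 'cV[R]_m) (y : 'cV[R]_m) : R :=
  lambda * (norm0 y)%:R + inner (W *m u1 - y) z1
  + tk / 2 * enorm (y - yk) ^+ 2 + rho / 2 * enorm (W *m u1 - y) ^+ 2.

(* [iterate A b W lambda beta rho t k u y z]: for some starting point and some
   choice of minimizers, (u, y, z) is the k-th iterate. A relation is needed
   since the y-subproblem may have several minimizers. *)
Inductive iterate (R : realType) (p n m : nat) (A : 'M[R]_(p, n))
    (b : 'cV[R]_p) (W : 'M[R]_(m, n)) (lambda beta rho : R) (t : nat -> R) :
    nat -> 'cV[R]_n -> 'cV[R]_m -> 'cV[R]_m -> Prop :=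
| iterate_init (u : 'cV[R]_n) :
    iterate A b W lambda beta rho t 0 u (W *m u) (zmap A b W beta u)
| iterate_step (k : nat) (u u1 : 'cV[R]_n) (y y1 z z1 : 'cV[R]_m) :
    iterate A b W lambda beta rho t k u y z ->
    global_minimizer (uobj A b W beta rho (t k) u y z) u1 ->
    z1 = zmap A b W beta u1 ->
    global_minimizer (yobj W lambda rho (t k) u1 y z1) y1 ->
    iterate A b W lambda beta rho t k.+1 u1 y1 z1.

(* Main.v *)
(** The u-objective is a quadratic whose Hessian M satisfies <d, M d> >= t |d|^2:
    expanding around the solution u1 of the normal equation leaves exactly
    <d, M d> / 2, so u1 is the unique minimizer. The y-objective is a sum of
    one-variable functions; completing the square turns each of them into
    lambda [s <> 0] + (rho + t) / 2 (s - w)^2 up to a constant, where only the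
    candidates s = 0 and s = w matter. *)
Require Import Defs.
From HB Require Import structures.
From mathcomp Require Import all_boot all_order all_algebra.
From mathcomp Require Import boolp classical_sets reals topology normedtype derive.
From mathcomp Require Import ring.
Set Implicit Arguments.
Unset Strict Implicit.
Unset Printing Implicit Defensive.
Import Order.TTheory GRing.Theory Num.Theory.
Import numFieldNormedType.Exports.
Local Open Scope ring_scope.

Lemma innerC (R : realType) (n : nat) (x y : 'cV[R]_n) : inner x y = inner y x.
Proof. by apply: eq_bigr => i _; rewrite mulrC. Qed.

Lemma innerDl (R : realType) (n : nat) (x y z : 'cV[R]_n) :
  inner (x + y) z = inner x z + inner y z.
Proof. by rewrite -big_split; apply: eq_bigr => i _; rewrite mxE mulrDl. Qed.

Lemma innerDr (R : realType) (n : nat) (x y z : 'cV[R]_n) :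
  inner x (y + z) = inner x y + inner x z.
Proof. by rewrite innerC innerDl !(innerC _ x). Qed.

Lemma innerZr (R : realType) (n : nat) (a : R) (x y : 'cV[R]_n) :
  inner x (a *: y) = a * inner x y.
Proof. by rewrite mulr_sumr; apply: eq_bigr => i _; rewrite mxE mulrCA. Qed.

Lemma innerNr (R : realType) (n : nat) (x y : 'cV[R]_n) :
  inner x (- y) = - inner x y.
Proof. by rewrite -sumrN; apply: eq_bigr => i _; rewrite mxE mulrN. Qed.

Lemma inner_mulmx (R : realType) (m n : nat) (A : 'M[R]_(m, n)) (x : 'cV[R]_n)
    (y : 'cV[R]_m) : inner (A *m x) y = inner x (A^T *m y).
Proof.
have innerE k (a c : 'cV[R]_k) : inner a c = (a^T *m c) 0 0.
  by rewrite mxE; apply: eq_bigr => i _; rewrite mxE.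
by rewrite !innerE trmx_mul mulmxA.
Qed.

Lemma inner_ge0 (R : realType) (n : nat) (x : 'cV[R]_n) : 0 <= inner x x.
Proof. by apply: sumr_ge0 => i _; rewrite -expr2 sqr_ge0. Qed.

Lemma inner_eq0 (R : realType) (n : nat) (x : 'cV[R]_n) :
  inner x x = 0 -> x = 0.
Proof.
move=> /psumr_eq0P x0; apply/colP => i; rewrite [RHS]mxE; apply/eqP.
rewrite -sqrf_eq0 expr2 x0 // => j _.
by rewrite -expr2 sqr_ge0.
Qed.

Lemma enorm_sqr (R : realType) (n : nat) (x : 'cV[R]_n) :
  enorm x ^+ 2 = inner x x.
Proof.
rewrite /enorm sqr_sqrtr; last by apply: sumr_ge0 => i _; rewrite sqr_ge0.
by apply: eq_bigr => i _; rewrite expr2.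
Qed.

Lemma enorm_sqrD (R : realType) (n : nat) (x y : 'cV[R]_n) :
  enorm (x + y) ^+ 2 = enorm x ^+ 2 + 2 * inner y x + enorm y ^+ 2.
Proof. by rewrite !enorm_sqr !innerDl !innerDr (innerC x y); ring. Qed.

(** A kernel vector [d] of [M] satisfies [inner d (M *m d) = 0], so the kernel is trivial. *)
Lemma posdef_unitmx (R : realType) (n : nat) (M : 'M[R]_n) :
  (forall d : 'cV[R]_n, inner d (M *m d) = 0 -> d = 0) -> M \in unitmx.
Proof.
(* [kermx] consists of row vectors acting on the left; transposing [M] turns them into columns to
   which [posM] applies. *)
move=> posM; rewrite -unitmx_tr -row_free_unit -kermx_eq0.
apply/rowV0P => v /sub_kermxP vM.
have Mv : M *m v^T = 0 by rewrite -[M]trmxK -trmx_mul vM trmx0.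
rewrite -[v]trmxK (posM v^T) ?trmx0 // Mv.
by rewrite /inner big1 // => i _; rewrite [X in _ * X]mxE mulr0.
Qed.

Section USubproblem.
Variables (R : realType) (p n m : nat) (A : 'M[R]_(p, n)) (b : 'cV[R]_p).
Variables (W : 'M[R]_(m, n)) (beta rho t : R).
Hypotheses (beta_gt0 : 0 < beta) (rho_gt0 : 0 < rho) (t_gt0 : 0 < t).

Let M : 'M[R]_n := A^T *m A + (beta + rho) *: (W^T *m W) + t%:M.

Let inner_hessian (d e : 'cV[R]_n) :
  inner d (M *m e) = inner (A *m d) (A *m e)
    + (beta + rho) * inner (W *m d) (W *m e) + t * inner d e.
Proof.
rewrite !inner_mulmx !mulmxDl -scalemxAl mul_scalar_mx.
by rewrite !innerDr !innerZr !mulmxA.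
Qed.

(** The terms in [A *m d] and [W *m d] are nonnegative multiples of squared norms; only the proximal
    term is kept. *)
Lemma hessian_coercive (d : 'cV[R]_n) :
  t * inner d d <= inner d (M *m d).
Proof.
rewrite inner_hessian lerDr addr_ge0 ?inner_ge0 //.
by rewrite mulr_ge0 ?inner_ge0 // ltW // addr_gt0.
Qed.

Lemma hessian_definite (d : 'cV[R]_n) : inner d (M *m d) <= 0 -> d = 0.
Proof.
move=> /(le_trans (hessian_coercive d)); rewrite pmulr_rle0 // => d0.
by apply: inner_eq0; apply/eqP; rewrite eq_le d0 inner_ge0.
Qed.

Lemma hessian_unitmx : M \in unitmx.
Proof. by apply: posdef_unitmx => d d0; apply: hessian_definite; rewrite d0. Qed.

Variables (uk : 'cV[R]_n) (yk zk : 'cV[R]_m).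

(** The gradient of the u-objective at [u] is [M *m u - c]. *)
Let c : 'cV[R]_n := A^T *m b - W^T *m zk + rho *: (W^T *m yk) + t *: uk.

(** The part of the increment linear in [d] is [inner d (M *m u - c)], which vanishes. *)
Lemma uobj_expand (u d : 'cV[R]_n) : M *m u = c ->
  uobj A b W beta rho t uk yk zk (u + d)
  = uobj A b W beta rho t uk yk zk u + 2^-1 * inner d (M *m d).
Proof.
move=> Mu; have := congr1 (inner d) Mu.
rewrite inner_hessian /c !innerDr innerNr !innerZr -!inner_mulmx => normal_eq.
rewrite inner_hessian /uobj /fid !mulmxDr.
(* Each residual at [u + d] is regrouped as the residual at [u] plus the image of [d]. *)
rewrite (addrAC (A *m u)) (addrAC (W *m u)) (addrAC u) !enorm_sqrD.
rewrite !innerDl !innerDr !innerNr !enorm_sqr.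
apply/eqP; rewrite -subr_eq0; apply/eqP.
(* The quadratic terms cancel in the difference; what remains is the linear part, left side minus
   right side of [normal_eq]. *)
transitivity (inner (A *m d) (A *m u)
    + (beta + rho) * inner (W *m d) (W *m u) + t * inner d u
    - (inner (A *m d) b - inner (W *m d) zk
       + rho * inner (W *m d) yk + t * inner d uk)).
  by field.
by rewrite normal_eq subrr.
Qed.

Lemma uobj_minimizer (v : 'cV[R]_n) :
  global_minimizer (uobj A b W beta rho t uk yk zk) v <-> v = invmx M *m c.
Proof.
set u1 := invmx M *m c.
have Mu1 : M *m u1 = c by rewrite /u1 mulmxA mulmxV ?mul1mx // hessian_unitmx.
have expand w : uobj A b W beta rho t uk yk zk w
    = uobj A b W beta rho t uk yk zk u1
      + 2^-1 * inner (w - u1) (M *m (w - u1)).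
  by rewrite -uobj_expand // subrKC.
split=> [minv | -> w].
  (* Comparing the minimizer [v] with [u1] forces the quadratic form at [v - u1] to be
     nonpositive. *)
  apply/eqP; rewrite -subr_eq0; apply/eqP; apply: hessian_definite.
  by have := minv u1; rewrite (expand v) gerDl pmulr_rle0 // invr_gt0.
rewrite (expand w) lerDl mulr_ge0 ?invr_ge0 //.
by apply: le_trans (hessian_coercive _); rewrite mulr_ge0 ?inner_ge0 // ltW.
Qed.

End USubproblem.

(** The choice [s = 0] costs [a / 2 * w ^+ 2], and every nonzero [s] costs at least [lambda],
    attained at [s = w] if [w] is nonzero. The threshold selects the cheaper of the two, and 0 in a
    tie. *)
Lemma hard_threshold_scalar (R : realType) (lambda a w s : R) :
  0 < lambda -> 0 < a ->
  let h := if Num.sqrt (2 * lambda / a) < `|w| then w else 0 in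
  lambda * (h != 0)%:R + a / 2 * (h - w) ^+ 2
  <= lambda * (s != 0)%:R + a / 2 * (s - w) ^+ 2.
Proof.
move=> lambda_gt0 a_gt0 /=.
have sq_ge0 (x : R) : 0 <= a / 2 * x ^+ 2.
  by rewrite mulr_ge0 ?sqr_ge0 // divr_ge0 // ltW.
have sqN : a / 2 * (0 - w) ^+ 2 = a / 2 * w ^+ 2 by rewrite sub0r sqrrN.
have thr : (Num.sqrt (2 * lambda / a) < `|w|) = (lambda < a / 2 * w ^+ 2).
  have -> : `|w| = Num.sqrt (w ^+ 2) by rewrite sqrtr_sqr.
  (* At [w = 0] both comparisons are false; otherwise [w ^+ 2] is positive, as [ltr_sqrt]
     requires. *)
  have [->|w0] := eqVneq w 0.
    by rewrite expr0n /= sqrtr0 mulr0 !ltNge sqrtr_ge0 ltW.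
  have w2 : 0 < w ^+ 2 by rewrite lt_def sqr_ge0 sqrf_eq0 w0.
  rewrite ltr_sqrt // ltr_pdivrMr // mulrC -ltr_pdivlMr // mulrC.
  by congr (_ < _); ring.
rewrite thr; case: ltP => [big|small].
  have -> : w != 0.
    by apply: contraTneq big => ->; rewrite expr0n /= mulr0 -leNgt ltW.
  rewrite subrr expr0n /= mulr0 addr0 mulr1.
  have [->|_] := eqVneq s 0; first by rewrite mulr0 add0r sqN ltW.
  by rewrite mulr1 lerDl.
rewrite eqxx mulr0 add0r sqN.
have [->|_] := eqVneq s 0; first by rewrite mulr0 add0r sqN.
by rewrite mulr1 (le_trans small) // lerDl.
Qed.

Lemma norm0_sum (R : realType) (n : nat) (x : 'cV[R]_n) :
  (norm0 x)%:R = \sum_(i < n) (x i 0 != 0)%:R :> R.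
Proof.
rewrite /norm0 cardsE -sum1_card natr_sum big_mkcond /=.
by apply: eq_bigr => i _; rewrite unfold_in; case: (_ != _).
Qed.

(** Separability: minimizing each summand on its own minimizes the whole. *)
Lemma yobj_sum (R : realType) (n m : nat) (W : 'M[R]_(m, n))
    (lambda rho t : R) (u : 'cV[R]_n) (yk z y : 'cV[R]_m) :
  yobj W lambda rho t u yk z y
  = \sum_(i < m) (lambda * (y i 0 != 0)%:R + ((W *m u) i 0 - y i 0) * z i 0
      + t / 2 * (y i 0 - yk i 0) ^+ 2
      + rho / 2 * ((W *m u) i 0 - y i 0) ^+ 2).
Proof.
rewrite /yobj norm0_sum !enorm_sqr /inner !mulr_sumr -!big_split /=.
have subE (a c : 'cV[R]_m) i : (a - c) i 0 = a i 0 - c i 0 by rewrite !mxE.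
by apply: eq_bigr => i _; rewrite !subE !expr2.
Qed.

Lemma yobj_minimizer (R : realType) (n m : nat) (W : 'M[R]_(m, n))
    (lambda rho t : R) (u : 'cV[R]_n) (yk z : 'cV[R]_m) :
  0 < lambda -> 0 < rho -> 0 < t ->
  global_minimizer (yobj W lambda rho t u yk z)
    (hard_threshold (Num.sqrt (2 * lambda / (rho + t)))
       ((rho / (rho + t)) *: (W *m u) + (t / (rho + t)) *: yk
        + (rho + t)^-1 *: z)).
Proof.
move=> lambda_gt0 rho_gt0 t_gt0 y; rewrite !yobj_sum; apply: ler_sum => i _.
have a_gt0 : 0 < rho + t by rewrite addr_gt0.
rewrite [hard_threshold _ _ _ _]mxE.
set w := (_ + _ + _ : 'cV[R]_m) i 0.
have -> : w = (rho * (W *m u) i 0 + t * yk i 0 + z i 0) / (rho + t).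
  have scaleE (a : R) (x : 'cV[R]_m) : (a *: x) i 0 = a * x i 0 by rewrite mxE.
  rewrite /w [LHS]mxE [X in X + _]mxE !scaleE.
  by field; rewrite gt_eqF.
(* From here on the problem is about real numbers only. *)
move: ((W *m u) i 0) (yk i 0) (z i 0) (y i 0) => q r v s {w}.
set w := (rho * q + t * r + v) / (rho + t).
(* The remainder of completing the square around [w]: it does not depend on the variable [x] and
   cancels in the comparison. *)
pose K := q * v + t / 2 * r ^+ 2 + rho / 2 * q ^+ 2
  - (rho + t) / 2 * w ^+ 2.
have square (l x : R) :
    l + (q - x) * v + t / 2 * (x - r) ^+ 2 + rho / 2 * (q - x) ^+ 2
    = l + (rho + t) / 2 * (x - w) ^+ 2 + K.
  by rewrite /K /w; field; rewrite gt_eqF.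
by rewrite !square lerD2r; apply: hard_threshold_scalar.
Qed.

Theorem theorem3p1 (R : realType) (p n m : nat) (A : 'M[R]_(p, n))
    (b : 'cV[R]_p) (W : 'M[R]_(m, n)) (lambda beta rho : R) (t : nat -> R)
    (hlambda : 0 < lambda) (hbeta : 0 < beta) (hrho : 0 < rho)
    (ht : forall k : nat, 0 < t k) (hW : \rank W = m)
    (k : nat) (uk : 'cV[R]_n) (yk zk : 'cV[R]_m)
    (hk : iterate A b W lambda beta rho t k uk yk zk) :
  let M : 'M[R]_n := A^T *m A + (beta + rho) *: (W^T *m W) + (t k)%:M in
  let u1 : 'cV[R]_n :=
    invmx M *m (A^T *m b - W^T *m zk + rho *: (W^T *m yk) + t k *: uk) in
  let z1 : 'cV[R]_m := zmap A b W beta u1 in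
  let y1 : 'cV[R]_m :=
    hard_threshold (Num.sqrt (2 * lambda / (rho + t k)))
      ((rho / (rho + t k)) *: (W *m u1) + (t k / (rho + t k)) *: yk
       + (rho + t k)^-1 *: z1) in
  [/\ M \in unitmx,
      forall v : 'cV[R]_n,
        global_minimizer (uobj A b W beta rho (t k) uk yk zk) v <-> v = u1
    & global_minimizer (yobj W lambda rho (t k) u1 yk z1) y1].
Proof.
split; first exact: hessian_unitmx.
  by move=> v; apply: uobj_minimizer.
exact: yobj_minimizer.
Qed.
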